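(* There exists a constant $C$ such that for every integer $n\ge 3$ the following holds. Every properly edge-colored complete graph on $n$ vertices contains a Hamiltonian cycle in which at least $n - C(\log n)^2$ distinct colors appear.
   Context: An edge-coloring of a graph is a proper edge-coloring if, for each vertex, the edges incident to that vertex are given distinct colors (any number of colors may be used). Logarithms are base $2$. *)

(* Defs.v *)
From mathcomp Require Import all_boot all_order all_algebra.
From mathcomp Require Import reals exp.

Set Implicit Arguments.
Unset Strict Implicit.
Unset Printing Implicit Defensive.

Definition log2 (R : realType) (x : R) : R := (ln x / ln 2)%R.

(* A simple graph on V is given by its edge set, each edge being a 2-element
   set of vertices. *)
Definition complete_graph (V : finType) : {set {set V}} :=
  [set e : {set V} | #|e| == 2].

(* Colors form an arbitrary, possibly infinite, type K; the values of c outside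
   the edge set E play no role. *)
Definition proper_edge_coloring (V : finType) (K : eqType)
    (E : {set {set V}}) (c : {set V} -> K) : Prop :=
  forall (v : V) (e f : {set V}), e \in E -> f \in E ->
    v \in e -> v \in f -> e != f -> c e != c f.

(* The cycle is given by the list of its vertices in cyclic order; requiring
   length at least 3 excludes the degenerate closed walk traversing one edge
   back and forth. *)
Definition hamiltonian_cycle (V : finType) (E : {set {set V}}) (s : seq V)
    : Prop :=
  [/\ 2 < size s, ucycle (fun x y => [set x; y] \in E) s
    & forall x : V, x \in s].

(* [next s] wraps around, so the closing edge is included. *)
Definition cycle_edges (V : finType) (s : seq V) : seq {set V} :=
  [seq [set x; next s x] | x <- s].

Definition num_colors (V : finType) (K : eqType) (c : {set V} -> K)
    (es : seq {set V}) : nat :=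
  size (undup [seq c e | e <- es]).

(* Main.v *)
(* The proof adapts the Shor / Hatami-Shor bound for partial transversals of Latin
   squares. Orient everything: take a largest rainbow set M of arcs forming
   disjoint directed paths, with k path ends and k path starts. Joining a path
   end x to the start y of another path must repeat a color of M, so the arc of
   that color can be removed instead, which frees a new end and a new start. For
   a state with i ends and i starts, let R be the set of ends freed by iterating
   this; then |R| = i + |A|, where A is the set of colors that move.
   Counting, for nested states s < top with r = |R(s)| and N = |R(top)|, the
   pairs (x, y) with x freed from s, y freed from top and color in A(s), one
   finds a state below s with one end and one start fewer and with
   N - |R| >= (13/8) (N - r) + 1, as long as |R| >= (7/8) N. So discarding
   O(log n) ends shrinks |R| by the factor 7/8, and discarding O(log^2 n) ends
   makes R empty: hence k = O(log^2 n). Finally M extends to a Hamiltonian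
   cycle. *)

Require Import Defs.
From mathcomp Require Import all_boot all_order all_algebra.
From mathcomp Require Import reals exp.
From mathcomp Require Import boolp zify.

Set Implicit Arguments.
Unset Strict Implicit.
Unset Printing Implicit Defensive.

(** * Directed linear forests and their completion to a Hamiltonian cycle *)

Section LinearForests.

Variable V : finType.
Implicit Types (M : {set V * V}) (x y z u v p q : V).

Definition arel M : rel V := fun x y => (x, y) \in M.

(** As [connect] is reflexive, the last clause rules out loops as well as longer cycles; the
    components are directed paths, possibly single vertices. *)
Definition linear_forest M :=
  [/\ forall x y z, (x, y) \in M -> (x, z) \in M -> y = z,
      forall x y z, (x, z) \in M -> (y, z) \in M -> x = y
    & forall x y, (x, y) \in M -> ~~ connect (arel M) y x].

Definition no_out M x := [forall y, (x, y) \notin M].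
Definition no_in M y := [forall x, (x, y) \notin M].

Lemma no_outP M x y : no_out M x -> (x, y) \notin M.
Proof. by move/forallP. Qed.

Lemma no_inP M x y : no_in M y -> (x, y) \notin M.
Proof. by move/forallP. Qed.

Lemma connect_arelS M M' x y :
  M \subset M' -> connect (arel M) x y -> connect (arel M') x y.
Proof.
move=> sMM'; apply: connect_sub => u v uv.
by apply: connect1; apply: (subsetP sMM').
Qed.

Lemma connect_arelU1 M x y u v :
  connect (arel ((x, y) |: M)) u v ->
  connect (arel M) u v \/ connect (arel M) u x /\ connect (arel M) y v.
Proof.
case/connectP=> s; elim: s u => [|w s IHs] u /=.
  by move=> _ ->; left; apply: connect0.
case/andP=> uw sw ev; have {sw ev} := IHs w sw ev.
have /predU1P[[-> ->]|{}uw] : ((u, w) == (x, y)) || ((u, w) \in M).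
- by rewrite -in_setU1.
- by move=> yv; right; split; [apply: connect0 | case: yv => [|[]]].
have cuw : connect (arel M) u w by apply: connect1.
by case=> [|[]] /(connect_trans cuw); [left | right].
Qed.

Lemma linear_forestS M M' : M' \subset M -> linear_forest M -> linear_forest M'.
Proof.
move=> sM [fM cM aM]; split=> [x y z|x y z|x y].
- by move=> /(subsetP sM) xy /(subsetP sM); apply: fM.
- by move=> /(subsetP sM) xy /(subsetP sM); apply: cM.
move=> /(subsetP sM)/aM; apply: contra; exact: connect_arelS.
Qed.

Lemma linear_forestU1 M x y :
  linear_forest M -> no_out M x -> no_in M y -> ~~ connect (arel M) y x ->
  linear_forest ((x, y) |: M).
Proof.
move=> [fM cM aM] ox iy nyx; split=> [u v w|u v w|u v]; rewrite !in_setU1.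
- case/predU1P=> [[-> ->]|uv]; case/predU1P=> [[]|uw] //.
  + by case/negP: (no_outP w ox).
  + by move=> eu; case/negP: (no_outP v ox); rewrite -eu.
  + exact: fM uv uw.
- case/predU1P=> [[-> ->]|uw]; case/predU1P=> [[]|vw] //.
  + by case/negP: (no_inP v iy).
  + by move=> _ ew; case/negP: (no_inP u iy); rewrite -ew.
  + exact: cM uw vw.
case/predU1P=> [[-> ->]|uv]; apply/negP => /connect_arelU1.
  by case=> [|[]]; rewrite (negPf nyx).
case=> [|[vx yu]]; first by rewrite (negPf (aM _ _ uv)).
case/negP: nyx; apply: connect_trans yu _; apply: connect_trans vx.
exact: connect1.
Qed.

Lemma no_out_connect M x y : no_out M x -> connect (arel M) x y -> x = y.
Proof.
move=> ox /connectP[[|w s] //= /andP[xw _]].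
by rewrite /arel (negPf (no_outP w ox)) in xw.
Qed.

Lemma connect_no_out_inj M x y z : linear_forest M ->
  connect (arel M) x y -> connect (arel M) x z -> no_out M y -> no_out M z ->
  y = z.
Proof.
move=> [fM _ _] /connectP[s]; elim: s x => [|w s IHs] x /=.
  by move=> _ -> xz ox _; apply: no_out_connect ox xz.
case/andP=> xw sw ey /connectP[[|w' s'] /=].
  by move=> _ -> _ oz; rewrite /arel (negPf (no_outP w oz)) in xw.
case/andP=> xw' sw' ez; apply: (IHs w) => //.
by apply/connectP; exists s' => //; rewrite ?(fM _ _ _ xw xw').
Qed.

Lemma connect_last M x z : connect (arel M) x z -> x != z ->
  exists2 w, connect (arel M) x w & (w, z) \in M.
Proof.
case/connectP=> s; elim/last_ind: s => [|s w _] /=; first by move=> _ ->; rewrite eqxx.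
rewrite rcons_path last_rcons => /andP[sx sw] -> _.
by exists (last x s) => //; apply/connectP; exists s.
Qed.

Lemma no_out_setD1 M x e : no_out M x -> no_out (M :\ e) x.
Proof. by move=> ox; apply/forallP=> y; rewrite in_setD1 (negPf (no_outP y ox)) andbF. Qed.

Lemma no_in_setD1 M x e : no_in M x -> no_in (M :\ e) x.
Proof. by move=> ox; apply/forallP=> y; rewrite in_setD1 (negPf (no_inP y ox)) andbF. Qed.

(** Every arc is determined by its tail. Together with [card_no_in], this gives as many path ends as
    path starts. *)
Lemma card_no_out M : linear_forest M -> #|[set x | no_out M x]| + #|M| = #|V|.
Proof.
case=> fM _ _; rewrite -(cardC [set x | no_out M x]); congr (_ + _).
rewrite -(@card_in_imset _ _ (fun e => e.1)) => [|[x y] [z w] /= xy zw]; last first.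
  by move=> exz; rewrite exz in xy *; rewrite (fM _ _ _ xy zw).
apply: eq_card => x; rewrite !inE negb_forall.
apply/imsetP/existsP=> [[[z y] xy /= ->]|[y]]; first by exists y; rewrite negbK.
by rewrite negbK => xy; exists (x, y).
Qed.

Lemma card_no_in M : linear_forest M -> #|[set x | no_in M x]| + #|M| = #|V|.
Proof.
case=> _ cM _; rewrite -(cardC [set x | no_in M x]); congr (_ + _).
rewrite -(@card_in_imset _ _ (fun e => e.2)) => [|[x y] [z w] /= xy zw]; last first.
  by move=> eyw; rewrite eyw in xy *; rewrite (cM _ _ _ xy zw).
apply: eq_card => y; rewrite !inE negb_forall.
apply/imsetP/existsP=> [[[x z] xy /= ->]|[x]]; first by exists x; rewrite negbK.
by rewrite negbK => xy; exists (x, y).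
Qed.

(** Among the vertices reachable from [y], take one that itself reaches the fewest; by acyclicity an
    arc out of it would lead to one reaching fewer. *)
Lemma ex_no_out M y : linear_forest M ->
  exists2 z, connect (arel M) y z & no_out M z.
Proof.
case=> _ _ aM; pose D z := [set v | connect (arel M) z v].
case: (@arg_minnP _ y (connect (arel M) y) (fun z => #|D z|) (connect0 _ _)).
move=> z yz minz; exists z => //; apply/forallP=> w; apply/negP=> zw.
have czw : connect (arel M) z w by apply: connect1.
have := minz w (connect_trans yz czw); rewrite leqNgt => /negP; apply.
apply: proper_card; apply/properP; split.
  by apply/subsetP=> v; rewrite !inE; apply: connect_trans.
by exists z; rewrite !inE ?connect0 // aM.
Qed.

(** Keep joining an end to the start of another path. When this is no longer possible, a single
    spanning path is left, which is what the last clause encodes. *)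
Lemma linear_forest_maximal M : linear_forest M ->
  exists M', [/\ M \subset M', linear_forest M' &
    forall x y, no_out M' x -> no_in M' y -> connect (arel M') y x].
Proof.
have [n] := ubnP (#|V| - #|M|); elim: n M => // n IHn M ltn lM.
have [[x y] /and3P[/= ox iy nyx]|full] :=
  pickP (fun e => [&& no_out M e.1, no_in M e.2 & ~~ connect (arel M) e.2 e.1]).
  have l1 := linear_forestU1 lM ox iy nyx.
  have [|//|M' [sM' lM' fM']] := IHn ((x, y) |: M).
    have := card_no_out l1; have := card_no_out lM.
    by rewrite cardsU1 (no_outP _ ox); lia.
  exists M'; split=> //; apply: subset_trans sM'; exact: subsetUr.
exists M; split=> // x y ox iy; apply: contraFT (full (x, y)) => nyx /=.
by rewrite ox iy.
Qed.

Lemma linear_forest_cycle M : 1 < #|V| -> linear_forest M ->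
  exists s : seq V, [/\ uniq s, forall x, x \in s,
    cycle (fun x y => x != y) s & forall x y, (x, y) \in M -> next s x = y].
Proof.
move=> V2 /linear_forest_maximal[M' [sM lM full]].
have [fM cM aM] := lM; have cO := card_no_out lM; have cI := card_no_in lM.
have /card_gt0P[v0 _] : 0 < #|V| by apply: ltnW.
have [x0 _ ox0] := ex_no_out v0 lM.
have /card_gt0P[y0] : 0 < #|[set y | no_in M' y]|.
  have : 0 < #|[set x | no_out M' x]| by apply/card_gt0P; exists x0; rewrite inE.
  by lia.
rewrite inE => iy0.
have uniq_out x : no_out M' x -> x = x0.
  by move=> ox; apply: connect_no_out_inj lM (full _ _ ox iy0) (full _ _ ox0 iy0) _ _.
(* The successor along the spanning path; the default [y0] closes it, sending its end [x0] back to
   its start. The cycle is the orbit of [x0] under [f]. *)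
pose f x := if [pick y | (x, y) \in M'] is Some y then y else y0.
have fP x y : (x, y) \in M' -> f x = y.
  rewrite /f; case: pickP => [z xz xy|/(_ y)->//]; exact: fM xz xy.
have fx0 x : (x, f x) \notin M' -> x = x0 /\ f x = y0.
  rewrite /f; case: pickP => [z -> //|nox _]; split=> //.
  by apply: uniq_out; apply/forallP=> y; rewrite nox.
have injf : injective f.
  move=> x x'; have [xM|/fx0[-> ->]] := boolP ((x, f x) \in M').
    have [xM'|/fx0[-> ->]] := boolP ((x', f x') \in M').
      by move=> e; rewrite e in xM; apply: cM xM xM'.
    by move=> e; rewrite e (negPf (no_inP _ iy0)) in xM.
  have [xM'|/fx0[-> ->]//] := boolP ((x', f x') \in M').
  by move=> e; rewrite -e (negPf (no_inP _ iy0)) in xM'.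
have to_x0 x : connect (arel M') x x0.
  by have [z xz /uniq_out<-] := ex_no_out x lM.
have fneq x : x != f x.
  have [xM|/fx0[-> ->]] := boolP ((x, f x) \in M').
    by apply: contraNneq (aM _ _ xM) => <-; apply: connect0.
  (* If [x0 = y0], no arc enters [x0], yet every vertex reaches it, so [x0] is the only vertex. *)
  apply: contraTneq V2 => exy; rewrite -leqNgt; apply/card_le1P=> v _ w.
  rewrite [RHS]inE; suff all0 u : u = x0 by rewrite (all0 v) (all0 w) eqxx.
  apply/eqP/contraT => /(connect_last (to_x0 u))[t _].
  by rewrite exy (negPf (no_inP _ iy0)).
have mem_orb x : x \in orbit f x0.
  rewrite -fconnect_orbit (fconnect_sym injf).
  apply: connect_sub (to_x0 x) => u v uv; apply: connect1 => /=.
  by rewrite (fP _ _ uv).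
have cyc := cycle_orbit injf x0.
exists (orbit f x0); split.
- exact: orbit_uniq.
- exact: mem_orb.
- by apply: sub_cycle cyc => x y /eqP <-.
move=> x y /(subsetP sM)/fP <-; apply/esym/eqP.
by have := next_cycle cyc (mem_orb x).
Qed.

End LinearForests.

(** * Color-preserving switches in a largest rainbow linear forest *)

Section Switching.

Variables (V K : finType) (col : V -> V -> K) (m : nat).
Hypothesis col_sym : forall x y, col x y = col y x.
Hypothesis col_inj : forall x y z, x != y -> x != z -> col x y = col x z -> y = z.

Implicit Types (M : {set V * V}) (x y z : V).

Definition rainbow M := {in M &, injective (fun e => col e.1 e.2)}.

Hypothesis max_rainbow : forall M, linear_forest M -> rainbow M -> #|M| <= m.

(* A set of arcs with the path ends ([outs]) and path starts ([ins]) that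
   switches may use; the other ends and starts are kept untouched. *)
Definition state : finType := ({set V * V} * {set V} * {set V})%type.
Implicit Types s t u v : state.

Definition arcs s : {set V * V} := s.1.1.
Definition outs s : {set V} := s.1.2.
Definition ins s : {set V} := s.2.

(** Adding [e] uses up the end [e.1] and the start [e.2]; removing [f] makes its tail an end and its
    head a start. *)
Definition switch s (e f : V * V) : state :=
  (e |: arcs s :\ f, f.1 |: outs s :\ e.1, f.2 |: ins s :\ e.2).

Definition switchable s (e f : V * V) :=
  [&& e.1 \in outs s, e.2 \in ins s, ~~ connect (arel (arcs s)) e.2 e.1,
      f \in arcs s & col e.1 e.2 == col f.1 f.2].

Definition step : rel state := fun s t =>
  [exists e, exists f, switchable s e f && (t == switch s e f)].

Lemma stepP s t :
  reflect (exists e f, switchable s e f /\ t = switch s e f) (step s t).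
Proof.
apply: (iffP existsP) => [[e /existsP[f /andP[? /eqP->]]]|[e [f [ef ->]]]].
  by exists e, f.
by exists e; apply/existsP; exists f; rewrite ef eqxx.
Qed.

Definition valid s :=
  [/\ linear_forest (arcs s), rainbow (arcs s), #|arcs s| = m,
      {in outs s, forall x, no_out (arcs s) x} &
      {in ins s, forall y, no_in (arcs s) y}].


(** Otherwise adding the arc [(x, y)] would give a rainbow linear forest with [m + 1] arcs. *)
Lemma valid_color s x y : valid s -> x \in outs s -> y \in ins s ->
  ~~ connect (arel (arcs s)) y x ->
  exists2 f, f \in arcs s & col x y = col f.1 f.2.
Proof.
case=> lM rM cM oM iM xs ys nyx.
have [f /andP[fs /eqP exy]|nof] := pickP [pred f in arcs s | col x y == col f.1 f.2].
  by exists f.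
have ox := oM _ xs; have iy := iM _ ys.
have: #|(x, y) |: arcs s| <= m.
  apply: max_rainbow; first exact: linear_forestU1.
  move=> e f; rewrite !in_setU1 => /predU1P[->|es] /predU1P[->|fs] //=.
  - by move=> exy; have := nof f; rewrite /= fs exy eqxx.
  - by move=> exy; have := nof e; rewrite /= es exy eqxx.
  exact: rM.
by rewrite cardsU1 (no_outP _ ox) cM ltnn.
Qed.

Lemma valid_switch s e f : valid s -> switchable s e f -> valid (switch s e f).
Proof.
case: e => x y [lM rM cM oM iM] /and5P[/= xs ys nyx fs /eqP exy].
have ox := oM _ xs; have iy := iM _ ys; have [fuM coM _] := lM.
split; rewrite /arcs /outs /ins /=.
- apply: linear_forestU1; rewrite ?no_out_setD1 ?no_in_setD1 //.
    by apply: linear_forestS lM; apply: subsetDl.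
  by apply: contra nyx; apply: connect_arelS; apply: subsetDl.
- move=> g h; rewrite !in_setU1 !in_setD1.
  case/predU1P=> [->|/andP[ngf gs]]; case/predU1P=> [->|/andP[nhf hs]] //=.
  + by rewrite exy => /(rM _ _ fs hs) efh; rewrite efh eqxx in nhf.
  + by rewrite exy => /(rM _ _ gs fs) efh; rewrite efh eqxx in ngf.
  exact: rM.
- have := cardsD1 f (arcs s); rewrite fs cM cardsU1 in_setD1.
  by rewrite (negPf (no_outP y ox)) andbF => ->.
- move=> z; rewrite in_setU1 in_setD1 => /predU1P[->|/andP[nzx zs]].
    apply/forallP=> w; rewrite in_setU1 in_setD1.
    apply/norP; split.
      apply/eqP=> -[efx _]; case/negP: (no_outP f.2 ox).
      by rewrite -efx -surjective_pairing.
    rewrite negb_and negbK; case: (boolP (_ \in _)) => [fw|]; last by rewrite orbT.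
    rewrite orbF; apply/eqP; case: f fs fw {exy} => p q /= fs fw.
    by rewrite (fuM _ _ _ fs fw).
  apply/forallP=> w; rewrite in_setU1 in_setD1 xpair_eqE (negPf nzx) /=.
  by rewrite (negPf (no_outP w (oM _ zs))) andbF.
move=> z; rewrite in_setU1 in_setD1 => /predU1P[->|/andP[nzx zs]].
  apply/forallP=> w; rewrite in_setU1 in_setD1.
  apply/norP; split.
    apply/eqP=> -[_ efy]; case/negP: (no_inP f.1 iy).
    by rewrite -efy -surjective_pairing.
  rewrite negb_and negbK; case: (boolP (_ \in _)) => [fw|]; last by rewrite orbT.
  rewrite orbF; apply/eqP; case: f fs fw {exy} => p q /= fs fw.
  by rewrite (coM _ _ _ fs fw).
apply/forallP=> w; rewrite in_setU1 in_setD1 xpair_eqE (negPf nzx) andbF /=.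
by rewrite (negPf (no_inP w (iM _ zs))) andbF.
Qed.

Lemma card_outs_switch s e f : valid s -> switchable s e f ->
  #|outs (switch s e f)| = #|outs s|.
Proof.
move=> [_ _ _ oM _] /and5P[es _ _ fs _]; rewrite /outs /= cardsU1 in_setD1.
rewrite -/(outs s) (cardsD1 e.1 (outs s)) es; case: (boolP (f.1 \in _)) => [fo|].
  by case/negP: (no_outP f.2 (oM _ fo)); rewrite -surjective_pairing.
by rewrite andbF.
Qed.

Lemma card_ins_switch s e f : valid s -> switchable s e f ->
  #|ins (switch s e f)| = #|ins s|.
Proof.
move=> [_ _ _ _ iM] /and5P[_ es _ fs _]; rewrite /ins /= cardsU1 in_setD1.
rewrite -/(ins s) (cardsD1 e.2 (ins s)) es; case: (boolP (f.2 \in _)) => [fo|].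
  by case/negP: (no_inP f.1 (iM _ fo)); rewrite -surjective_pairing.
by rewrite andbF.
Qed.

(** * Vertices and colors reachable by switches *)

Lemma reach_ind (P : state -> Prop) s :
    P s -> (forall t t', connect step s t -> P t -> step t t' -> P t') ->
  forall t, connect step s t -> P t.
Proof.
move=> Ps Pstep t /connectP[r]; elim/last_ind: r t => [|r u IHr] t /=.
  by move=> _ ->.
rewrite rcons_path last_rcons => /andP[sr ru] ->.
apply: (Pstep (last s r)) => //; last exact: IHr.
by apply/connectP; exists r.
Qed.

Lemma reach_valid s t : valid s -> connect step s t ->
  [/\ valid t, #|outs t| = #|outs s| & #|ins t| = #|ins s|].
Proof.
move=> vs; elim/reach_ind => // {}t u _ [vt <- <-] /stepP[e [f [ef ->]]].
by rewrite card_outs_switch ?card_ins_switch //; split=> //; apply: valid_switch.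
Qed.

(* The vertices that can be freed as path ends, resp. as path starts; they index
   the rows and columns of the Latin square of the original argument. *)
Definition rows s := [set x | [exists t, connect step s t && (x \in outs t)]].
Definition cols s := [set y | [exists t, connect step s t && (y \in ins t)]].

Lemma rowsP s x :
  reflect (exists2 t, connect step s t & x \in outs t) (x \in rows s).
Proof.
rewrite inE; apply: (iffP existsP) => [[t /andP[]]|[t st xt]]; first by exists t.
by exists t; rewrite st.
Qed.

Lemma colsP s y :
  reflect (exists2 t, connect step s t & y \in ins t) (y \in cols s).
Proof.
rewrite inE; apply: (iffP existsP) => [[t /andP[]]|[t st yt]]; first by exists t.
by exists t; rewrite st.
Qed.

Lemma sub_outs_rows s : outs s \subset rows s.
Proof. by apply/subsetP=> x xs; apply/rowsP; exists s. Qed.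

Lemma sub_ins_cols s : ins s \subset cols s.
Proof. by apply/subsetP=> x xs; apply/colsP; exists s. Qed.

(** The switch that removes [e] frees its tail and its head at the same time. *)
Lemma removed_arc s t e : connect step s t ->
  e \in arcs s -> e \notin arcs t -> (e.1 \in rows s) && (e.2 \in cols s).
Proof.
move=> st es; elim/reach_ind: st => [|{}t u st IHt tu]; first by rewrite es.
have su := connect_trans st (connect1 tu).
case/stepP: tu => g [f [gf eu]]; case: (boolP (e \in arcs t)) => [et|/IHt //].
rewrite {1}eu /arcs /= in_setU1 in_setD1 et andbT negb_or negbK.
case/andP=> _ /eqP ef.
apply/andP; split; [apply/rowsP | apply/colsP]; exists u => //.
  by rewrite eu /outs /= ef setU11.
by rewrite eu /ins /= ef setU11.
Qed.

Lemma reach_color s t f : connect step s t -> f \in arcs t ->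
  exists2 e, e \in arcs s & col e.1 e.2 = col f.1 f.2.
Proof.
move=> st; elim/reach_ind: st f => [f fs|{}t u _ IHt /stepP[g [h [gh ->]]] f].
  by exists f.
case/and5P: gh => _ _ _ ht /eqP egh.
rewrite /arcs /= in_setU1 in_setD1 => /predU1P[->|/andP[_ /IHt //]].
by rewrite egh; apply: IHt.
Qed.

(** For valid [s] these are exactly the arcs missing from some reachable state: a freed tail has no
    outgoing arc, and conversely [removed_arc] applies. *)
Definition moved_arcs s := [set e in arcs s | e.1 \in rows s].
Definition moved s := [set col e.1 e.2 | e in moved_arcs s].

(** Consider the arc of [s] with the color of [f]. If it survives in [t], it is [f] by rainbowness;
    if not, it was removed and its tail freed. *)
Lemma color_moved s t f : valid s -> connect step s t -> f \in arcs t ->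
  f.1 \in rows s -> col f.1 f.2 \in moved s.
Proof.
move=> vs st ft fr; have [[_ rt _ _ _] _ _] := reach_valid vs st.
have [e es eef] := reach_color st ft.
rewrite -eef; apply: (imset_f (fun e => col e.1 e.2)); rewrite in_set es /=.
have [et|net] := boolP (e \in arcs t); first by rewrite (rt _ _ et ft eef).
by case/andP: (removed_arc st es net).
Qed.

(** By maximality the color of the join already occurs on an arc of [t]; switching that arc out
    frees its tail. *)
Lemma color_joinable s t x y : valid s -> connect step s t ->
    x \in outs t -> y \in ins t -> ~~ connect (arel (arcs t)) y x ->
  col x y \in moved s.
Proof.
move=> vs st xt yt nyx; have [vt _ _] := reach_valid vs st.
have [f ft exy] := valid_color vt xt yt nyx.
rewrite exy; apply: (color_moved vs st ft).
apply/rowsP; exists (switch t (x, y) f); last by rewrite /outs /= setU11.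
apply: connect_trans st (connect1 _); apply/stepP; exists (x, y), f.
by split=> //; apply/and5P; split=> //=; apply/eqP.
Qed.

(** Freeing either endpoint of an arc in the relevant direction forces its removal, which frees the
    other endpoint too. *)
Lemma moved_arcsE s : valid s ->
  moved_arcs s = [set e in arcs s | e.2 \in cols s].
Proof.
move=> vs; apply/setP=> e; rewrite [LHS]in_set [RHS]in_set; apply: andb_id2l => es.
apply/rowsP/colsP => -[t st et]; have [[_ _ _ ot it] _ _] := reach_valid vs st.
  have: e \notin arcs t by rewrite [e]surjective_pairing no_outP // ot.
  by case/(removed_arc st es)/andP=> _ /colsP.
have: e \notin arcs t by rewrite [e]surjective_pairing no_inP // it.
by case/(removed_arc st es)/andP=> /rowsP.
Qed.

(** A switch only exchanges the roles of end and tail, so the ends and tails of any reachable state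
    were already ends or tails in [s]. *)
Lemma rowsE s : rows s = outs s :|: [set e.1 | e in moved_arcs s].
Proof.
apply/eqP; rewrite eqEsubset; apply/andP; split; last first.
  rewrite subUset sub_outs_rows /=; apply/subsetP=> _ /imsetP[e + ->].
  by rewrite in_set => /andP[].
apply/subsetP=> x xs; have /rowsP[t st xt] := xs.
suff: x \in outs s :|: [set e.1 | e in arcs s].
  rewrite !in_setU => /orP[->//|/imsetP[e es ex]]; apply/orP; right.
  by apply/imsetP; exists e => //; rewrite in_set es -ex.
suff [-> //]: {subset outs t <= outs s :|: [set e.1 | e in arcs s]} /\
  {in arcs t, forall e, e.1 \in outs s :|: [set e.1 | e in arcs s]}.
elim/reach_ind: st {x xs xt} => [|{}t u _ [IHo IHa] /stepP[e [f [ef ->]]]].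
  split=> [x xs|e es]; rewrite in_setU ?xs //.
  by rewrite imset_f ?orbT.
have /and5P[eo _ _ fa _] := ef; split=> x.
  rewrite /outs in_setU1 in_setD1 => /predU1P[->|/andP[_]]; first exact: IHa.
  exact: IHo.
rewrite /arcs in_setU1 in_setD1 => /predU1P[->|/andP[_]]; first exact: IHo.
exact: IHa.
Qed.

Lemma colsE s : valid s -> cols s = ins s :|: [set e.2 | e in moved_arcs s].
Proof.
move=> vs; rewrite moved_arcsE //; apply/eqP; rewrite eqEsubset.
apply/andP; split; last first.
  rewrite subUset sub_ins_cols /=; apply/subsetP=> _ /imsetP[e + ->].
  by rewrite in_set => /andP[].
apply/subsetP=> x xs; have /colsP[t st xt] := xs.
suff: x \in ins s :|: [set e.2 | e in arcs s].
  rewrite !in_setU => /orP[->//|/imsetP[e es ex]]; apply/orP; right.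
  by apply/imsetP; exists e => //; rewrite in_set es -ex.
suff [-> //]: {subset ins t <= ins s :|: [set e.2 | e in arcs s]} /\
  {in arcs t, forall e, e.2 \in ins s :|: [set e.2 | e in arcs s]}.
elim/reach_ind: st {x xs xt} => [|{}t u _ [IHo IHa] /stepP[e [f [ef ->]]]].
  split=> [x xs|e es]; rewrite in_setU ?xs //.
  by rewrite imset_f ?orbT.
have /and5P[_ eo _ fa _] := ef; split=> x.
  rewrite /ins in_setU1 in_setD1 => /predU1P[->|/andP[_]]; first exact: IHa.
  exact: IHo.
rewrite /arcs in_setU1 in_setD1 => /predU1P[->|/andP[_]]; first exact: IHo.
exact: IHa.
Qed.

Lemma card_moved s : valid s -> #|moved s| = #|moved_arcs s|.
Proof.
case=> _ rM _ _ _; apply: card_in_imset => e f.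
by rewrite !in_set => /andP[es _] /andP[fs _]; apply: rM.
Qed.

Lemma card_rows s : valid s -> #|rows s| = #|outs s| + #|moved s|.
Proof.
move=> vs; have [[fM _ _] _ _ oM _] := vs.
rewrite card_moved // rowsE cardsU disjoint_setI0 ?cards0 ?subn0.
  congr (_ + _); apply: card_in_imset => -[x y] [z w]; rewrite !in_set.
  by case/andP=> xy _ /andP[zw _] /= exz; rewrite exz in xy *; rewrite (fM _ _ _ xy zw).
rewrite disjoint_sym disjoints_subset; apply/subsetP=> _ /imsetP[e + ->].
rewrite in_set in_setC => /andP[es _]; apply/negP => /oM /(no_outP e.2).
by rewrite -surjective_pairing es.
Qed.

Lemma card_cols s : valid s -> #|cols s| = #|ins s| + #|moved s|.
Proof.
move=> vs; have [[_ cM _] _ _ _ iM] := vs.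
rewrite card_moved // colsE // cardsU disjoint_setI0 ?cards0 ?subn0.
  congr (_ + _); apply: card_in_imset => -[x y] [z w]; rewrite !in_set.
  by case/andP=> xy _ /andP[zw _] /= eyw; rewrite eyw in xy *; rewrite (cM _ _ _ xy zw).
rewrite disjoint_sym disjoints_subset; apply/subsetP=> _ /imsetP[e + ->].
rewrite in_set in_setC => /andP[es _]; apply/negP => /iM /(no_inP e.1).
by rewrite -surjective_pairing es.
Qed.

(** * Discarding ends and starts *)

Definition restricts s t :=
  [/\ arcs s = arcs t, outs s \subset outs t & ins s \subset ins t].

Definition substate s t := exists2 u, connect step t u & restricts s u.

Lemma restricts_switch s t e f : restricts s t -> switchable s e f ->
  switchable t e f /\ restricts (switch s e f) (switch t e f).
Proof.
move=> [est so si] /and5P[eo ei nc fs cf]; split.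
  by apply/and5P; rewrite -est; split=> //; [apply: (subsetP so)|apply: (subsetP si)].
split; rewrite /arcs /outs /ins /=.
- by rewrite -/(arcs s) est.
- by apply: setUS; apply: setSD.
by apply: setUS; apply: setSD.
Qed.

Lemma restricts_reach s t s' : restricts s t -> connect step s s' ->
  exists2 t', connect step t t' & restricts s' t'.
Proof.
move=> rst; elim/reach_ind; first by exists t.
move=> u v _ [t' tt' ru] /stepP[e [f [ef ->]]].
have [ef' rv] := restricts_switch ru ef.
exists (switch t' e f) => //; apply: connect_trans tt' (connect1 _).
by apply/stepP; exists e, f.
Qed.

Lemma substate_refl s : substate s s.
Proof. by exists s. Qed.

(** Switches made after discarding can be made before it, by [restricts_reach], so the two phases
    commute. *)
Lemma substate_trans s t u : substate s t -> substate t u -> substate s u.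
Proof.
move=> [t' tt' [est so si]] [u' uu' rtu].
have [u'' uu'' [etu so' si']] := restricts_reach rtu tt'.
exists u''; first exact: connect_trans uu' uu''.
by split; [rewrite est | apply: subset_trans so'|apply: subset_trans si'].
Qed.

Lemma valid_restricts s t : restricts s t -> valid t -> valid s.
Proof.
move=> [est so si] [lM rM cM oM iM]; split; rewrite ?est //.
  by move=> x /(subsetP so)/oM.
by move=> x /(subsetP si)/iM.
Qed.

Lemma valid_substate s t : valid t -> substate s t -> valid s.
Proof.
move=> vt [u tu ru]; apply: valid_restricts ru _.
by have [] := reach_valid vt tu.
Qed.

Lemma substate_reach s t s' : substate s t -> connect step s s' ->
  substate s' t.
Proof.
move=> [u tu rsu] /(restricts_reach rsu)[u' uu' ru'].
by exists u' => //; apply: connect_trans uu'.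
Qed.

Lemma substate_rows s t : substate s t -> rows s \subset rows t.
Proof.
move=> st; apply/subsetP=> x /rowsP[s' ss' xs'].
have [u tu [_ so _]] := substate_reach st ss'.
by apply/rowsP; exists u => //; apply: (subsetP so).
Qed.

Lemma substate_cols s t : substate s t -> cols s \subset cols t.
Proof.
move=> st; apply/subsetP=> x /colsP[s' ss' xs'].
have [u tu [_ _ si]] := substate_reach st ss'.
by apply/colsP; exists u => //; apply: (subsetP si).
Qed.

Lemma substate_moved s t : valid t -> substate s t -> moved s \subset moved t.
Proof.
move=> vt st; apply/subsetP=> _ /imsetP[e + ->]; rewrite in_set => /andP[es er].
have [u tu [esu _ _]] := st; apply: (color_moved vt tu).
  by rewrite -esu.
exact: (subsetP (substate_rows st)).
Qed.

(* Choosing the state in which the path starting at [y] is shortest forces all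
   switches that leave both ends of that path alone to avoid it, so that no
   vertex they free can close a cycle with [y]. *)
Lemma drop_col s y : valid s -> 0 < #|outs s| -> y \in cols s ->
  exists2 s', substate s' s &
    [/\ #|outs s'|.+1 = #|outs s|, #|ins s'|.+1 = #|ins s| &
        {in rows s', forall x, x != y /\ col x y \in moved s}].
Proof.
move=> vs os /colsP[t0 st0 yt0].
pose D t := [set v | connect (arel (arcs t)) y v].
case: (@arg_minnP _ t0 (fun t => connect step s t && (y \in ins t))
  (fun t => #|D t|)); first by rewrite st0.
move=> t /andP[st yt] mint; have [vt cot cit] := reach_valid vs st.
have [lM _ _ oM iM] := vt.
(* [z] is the end of the path from [y] if that end is available, and any available end otherwise.
   Without [z], no available end lies on this path. *)
have [z zt zD] : exists2 z, z \in outs t & [disjoint outs t :\ z & D t].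
  have [z /andP[zt zD]|noz] := pickP [pred z in outs t | z \in D t].
    exists z => //; rewrite disjoints_subset; apply/subsetP=> x.
    rewrite !inE => /andP[nxz xt]; apply: contra nxz => yx.
    rewrite inE in zD; apply/eqP.
    by apply: (connect_no_out_inj lM yx zD); apply: oM.
  have /card_gt0P[z zt] : 0 < #|outs t| by rewrite cot.
  exists z => //; rewrite disjoints_subset; apply/subsetP=> x; rewrite !inE.
  by case/andP=> _ xt; have := noz x; rewrite !inE xt /= => ->.
pose s' : state := (arcs t, outs t :\ z, ins t :\ y).
have rs' : restricts s' t by split=> //; apply: subsetDl.
exists s'; first by exists t.
split.
- by rewrite -cot (cardsD1 z (outs t)) zt.
- by rewrite -cit (cardsD1 y (ins t)) yt.
move=> x /rowsP[u' su' xu'].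
(* The invariant follows a lift [u] of [u'] in which [y] is still a start, while the path from [y]
   has not grown and avoids the available ends. *)
suff [u [tu [eu so si] yu nyu [dis _]]] : exists u, [/\ connect step t u,
    restricts u' u, y \in ins u, y \notin ins u' &
    [disjoint outs u' & D u] /\ D u \subset D t].
  have nyx : ~~ connect (arel (arcs u)) y x.
    have := disjointFr dis xu'; rewrite inE => ->; by [].
  split; first by apply: contraNneq nyx => ->; apply: connect0.
  apply: color_joinable nyx => //; first exact: connect_trans st tu.
  exact: (subsetP so).
elim/reach_ind: su' {x xu'} => [|{}u' v' su' [u [tu ru yu nyu [dis Dut]]]].
  by exists t; split=> //; rewrite !inE eqxx.
case/stepP=> e [f [ef ->]]; have [ef' rv] := restricts_switch ru ef.
have [eu so si] := ru; have [vu _ _] := reach_valid vt tu.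
have [lu _ _ ou iu] := vu; have [_ cu _] := lu.
set v := switch u e f in rv *.
have tv : connect step t v.
  by apply: connect_trans tu (connect1 _); apply/stepP; exists e, f.
have /and5P[eo ei _ fu' _] := ef.
have fu : f \in arcs u by rewrite -eu.
have nfy : f.2 != y.
  apply: contraTneq fu => efy; rewrite [f]surjective_pairing efy.
  by apply: no_inP; apply: iu.
have ney : e.2 != y by apply: contraNneq nyu => <-.
have yv : y \in ins v by rewrite /ins /= in_setU1 in_setD1 [y == e.2]eq_sym ney yu orbT.
have neD : e.1 \notin D u by rewrite (disjointFr dis eo).
have Dvu : D v \subset D u.
  apply/subsetP=> w; rewrite !inE {1}/arcs /= [e]surjective_pairing.
  have sDM : arcs u :\ f \subset arcs u by apply: subsetDl.
  case/connect_arelU1 => [|[/(connect_arelS sDM) ye _]].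
    exact: connect_arelS.
  by rewrite inE ye in neD.
(* The path cannot shrink either, by the minimal choice of [t]. *)
have eDvu : D v = D u.
  apply/eqP; rewrite eqEcard Dvu /=; apply: leq_trans (subset_leq_card Dut) _.
  by apply: mint; rewrite yv andbT; apply: connect_trans tv.
(* Were [f] on the path, [f.2] would still be reached from [y] after its removal, hence through
   another arc; but in-degrees are at most one and [e] enters a start of [u]. *)
have nf1 : f.1 \notin D u.
  apply/negP=> f1; have: f.2 \in D v.
    rewrite eDvu; rewrite !inE in f1 *; apply: connect_trans f1 (connect1 _).
    by rewrite /arel -surjective_pairing.
  rewrite inE => yf2; have [|w _] := connect_last yf2; first by rewrite eq_sym.
  rewrite /arcs /= in_setU1 in_setD1 => /predU1P[ew|/andP[nwf wu]].
    have [_ _ _ _ iv] := vu.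
    have := iv e.2 (subsetP si _ ei) => /(no_inP f.1).
    by rewrite -ew /= -surjective_pairing fu.
  case/eqP: nwf; rewrite [f]surjective_pairing; congr (_, _).
  by apply: cu wu _; rewrite -surjective_pairing.
exists v; split=> //.
  by rewrite /ins /= in_setU1 in_setD1 (negPf nyu) eq_sym (negPf nfy) andbF.
split; last by rewrite eDvu.
rewrite eDvu disjoints_subset; apply/subsetP=> w.
rewrite /outs /= in_setU1 in_setD1 => /predU1P[->|/andP[_ wu']].
  by rewrite inE.
by rewrite inE (disjointFr dis wu').
Qed.

(** * Double counting and the shrinking of the set of freed ends *)

Lemma double_count_card (A B : {set V}) (P : rel V) :
  \sum_(x in A) #|[set y in B | P x y]| = \sum_(y in B) #|[set x in A | P x y]|.
Proof.
transitivity (\sum_(x in A) \sum_(y in B | P x y) 1).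
  by apply: eq_bigr => x _; rewrite -sum1_card; apply: eq_bigl => y; rewrite inE.
rewrite (exchange_big_dep (mem B)) => [|x y _ /andP[]//]; apply: eq_bigr => y yB.
by rewrite -sum1_card; apply: eq_bigl => x; rewrite inE (yB : y \in B).
Qed.

Lemma card_color_row x (B : {set V}) (A : {set K}) :
  #|[set y in B | (x != y) && (col x y \in A)]| <= #|A|.
Proof.
rewrite -(@card_in_imset _ _ (col x)) => [|y z]; last first.
  by rewrite !inE => /and3P[_ ? _] /and3P[_ ? _]; apply: col_inj.
apply: subset_leq_card; apply/subsetP=> _ /imsetP[y + ->].
by rewrite inE => /and3P[].
Qed.

Lemma card_color_col y (B : {set V}) (A : {set K}) :
  #|[set x in B | (x != y) && (col x y \in A)]| <= #|A|.
Proof.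
rewrite -(eq_card (A := [set x in B | (y != x) && (col y x \in A)])).
  exact: card_color_row.
by move=> x; rewrite !inE eq_sym col_sym.
Qed.

(** Write [r] and [N] for the sizes of [rows s] and [rows top]. Pairs in [rows s] times [cols top]
    with a color in [moved s] are counted by rows ([upper]), by columns of [s] ([lower1]) and by the
    other [N - r] columns ([lower2]). *)
Lemma shrink_step top s : valid top -> #|outs top| = #|ins top| ->
    substate s top -> #|outs s| = #|ins s| -> 0 < #|outs s| ->
    7 * #|rows top| <= 8 * #|rows s| ->
  exists2 s', substate s' top &
    [/\ #|outs s'| = #|ins s'|, #|outs s| <= #|outs s'|.+1 &
        8 * #|rows s'| < 7 * #|rows top| \/
        8 * #|rows s'| + 5 * (#|rows top| - #|rows s|) + 8 <= 8 * #|rows s|].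
Proof.
move=> vt eot sst eos os large; have vs := valid_substate vt sst.
have os_le : #|outs s| <= #|outs top|.
  have [u tu [_ so _]] := sst; have [_ <- _] := reach_valid vt tu.
  exact: subset_leq_card.
pose drop u y w := substate w u /\
    [/\ #|outs w|.+1 = #|outs u|, #|ins w|.+1 = #|ins u| &
        {in rows w, forall x, x != y /\ col x y \in moved u}].
have choose_drop u : valid u -> 0 < #|outs u| -> exists f : V -> state,
    forall y, y \in cols u -> drop u y (f y).
  move=> vu ou.
  apply: (@fin_all_exists V (fun=> state) (fun y w => y \in cols u -> drop u y w)).
  move=> y.
  have [yu|] := boolP (y \in cols u); last by exists u.
  by have [u' ? ?] := drop_col vu ou yu; exists u'.
have [f fP] := choose_drop top vt (leq_trans os os_le).
have [g gP] := choose_drop s vs os.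
have [y0 /andP[y0t small]|nosmall] :=
    pickP [pred y in cols top | 8 * #|rows (f y)| < 7 * #|rows top|].
  have [sub [ho hi _]] := fP _ y0t; exists (f y0) => //.
  split; [by apply: succn_inj; rewrite ho hi | by rewrite ho | by left].
have [y1 y1s] : exists y, y \in cols s.
  by apply/card_gt0P; rewrite card_cols // -eos ltn_addr.
(* Dropping the column that leaves the fewest rows makes [b] a lower bound for all columns of
   [s]. *)
case: (@arg_minnP _ y1 (fun y => y \in cols s) (fun y => #|rows (g y)|) y1s).
move=> y ys miny; have [sub [ho hi _]] := gP _ ys.
exists (g y); first exact: substate_trans sub sst.
split; [by apply: succn_inj; rewrite ho hi | by rewrite ho | right].
set b := #|rows (g y)|.
have cr := card_rows vs; have cc := card_cols vs.
have ctr := card_rows vt; have ctc := card_cols vt.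
have rs_le := subset_leq_card (substate_rows sst).
pose P x y := (x != y) && (col x y \in moved s).
have upper : \sum_(y in cols top) #|[set x in rows s | P x y]|
    <= #|rows s| * #|moved s|.
  rewrite -double_count_card -sum_nat_const; apply: leq_sum => x _.
  exact: card_color_row.
have lower1 z : z \in cols s -> b <= #|[set x in rows s | P x z]|.
  move=> zs; apply: leq_trans (miny _ zs) _; apply: subset_leq_card.
  have [subz [_ _ jz]] := gP _ zs; apply/subsetP=> x xz.
  have [nxz mxz] := jz x xz; rewrite in_set (subsetP (substate_rows subz)) //.
  by rewrite /P nxz.
(* At least [r - N/8] vertices of [rows s] survive dropping [z] from [top]; at most [N - r] of them
   have a color that moves from [top] but not from [s]. This leaves [2r - 9N/8]. *)
have lower2 z : z \in cols top ->
    16 * #|rows s| <= 8 * #|[set x in rows s | P x z]| + 9 * #|rows top|.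
  move=> zt; have [subz [_ _ jz]] := fP _ zt.
  have := nosmall z; rewrite /= zt /= => /negbT; rewrite -leqNgt => largez.
  pose S2 := [set x in rows (f z) | (x != z) && (col x z \in moved top :\: moved s)].
  have cS2 : #|S2| <= #|moved top| - #|moved s|.
    rewrite -[#|moved s|](congr1 (fun A : {set K} => #|A|) (setIidPr (substate_moved vt sst))).
    by rewrite -cardsD; apply: card_color_col.
  have cI : #|rows (f z) :&: rows s| <= #|[set x in rows s | P x z]| + #|S2|.
    apply: leq_trans (leq_of_leqif (leq_card_setU _ _)); apply: subset_leq_card.
    apply/subsetP=> x; rewrite in_setI => /andP[xf xs].
    have [nxz mxz] := jz _ xf; rewrite in_setU [x \in finset _]in_set.
    rewrite [x \in S2]in_set in_setD xs xf /P nxz mxz /= andbT.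
    by rewrite orbN.
  have cU : #|rows (f z) :|: rows s| <= #|rows top|.
    by apply: subset_leq_card; rewrite subUset !substate_rows.
  have := cardsUI (rows (f z)) (rows s).
  clear -cU cI cS2 largez os_le cr ctr rs_le. lia.

have ccs : cols s \subset cols top := substate_cols sst.
have cD : #|cols top :\: cols s| = #|rows top| - #|rows s|.
  by rewrite cardsD (setIidPr ccs) cc ctc cr ctr eos eot.
have sum1 : #|rows s| * (8 * b) <=
    \sum_(z in cols s) 8 * #|[set x in rows s | P x z]|.
  rewrite cr eos -cc -sum_nat_const; apply: leq_sum => z zs.
  by rewrite leq_mul2l lower1.
have sum2 : (#|rows top| - #|rows s|) * (16 * #|rows s|) <=
    \sum_(z in cols top :\: cols s) 8 * #|[set x in rows s | P x z]| +
    (#|rows top| - #|rows s|) * (9 * #|rows top|).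
  rewrite -cD -!sum_nat_const -big_split /=; apply: leq_sum => z.
  by rewrite in_setD => /andP[_]; apply: lower2.
have sum12 : \sum_(z in cols s) 8 * #|[set x in rows s | P x z]| +
    \sum_(z in cols top :\: cols s) 8 * #|[set x in rows s | P x z]| <=
    8 * (#|rows s| * #|moved s|).
  apply: leq_trans (_ : 8 * \sum_(y in cols top) #|[set x in rows s | P x y]| <= _).
    rewrite [X in _ <= 8 * X](big_setID (cols s)) /= (setIidPr ccs) mulnDr !big_distrr /=.
    by rewrite leqnn.
  by rewrite leq_mul2l upper.
have := leq_add sum1 sum2.
set r := #|rows s| in cr rs_le large sum12 *; set N := #|rows top| in rs_le large *.
set D := N - r; set A1 := \sum_(z in cols s) _; set A2 := \sum_(z in _) _.
rewrite -/A1 -/A2 in sum12.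
move=> sum12'.
have : r * (8 * b) + D * (16 * r) <= 8 * (r * #|moved s|) + D * (9 * N) by lia.
(* From [7N <= 8r], [2r - 9N/8 >= 5r/7], which is at least [5r/8]. Since [moved s] has at most
   [r - 1] colors, dividing by [r] gives the claim. *)
clear -cr rs_le large os. rewrite {}/D.
nia.
Qed.

(** Since [(13/8)^2 > 2], two steps at least double [N - r + 1], where [N] and [r] count the rows of
    [top] and of the current state. Without an earlier success, [T] doublings leave no rows at all,
    because [N < 2 ^ T]. *)
Lemma shrink_stage top T : valid top -> #|outs top| = #|ins top| ->
    0 < #|rows top| < 2 ^ T -> T.*2 <= #|outs top| ->
  exists2 s, substate s top &
    [/\ #|outs s| = #|ins s|, #|outs top| <= #|outs s| + T.*2 &
        8 * #|rows s| < 7 * #|rows top|].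
Proof.
move=> vt eot /andP[N0 NT] lT.
suff /(_ T (leqnn T)) [s sst [eos los dich]] : forall j, j <= T ->
    exists2 s, substate s top &
    [/\ #|outs s| = #|ins s|, #|outs top| <= #|outs s| + j.*2 &
        8 * #|rows s| < 7 * #|rows top| \/ #|rows s| + 2 ^ j <= #|rows top|.+1].
  by exists s => //; split=> //; lia.
elim=> [_|j IHj ltjT].
  by exists top; [apply: substate_refl | rewrite addn0 addn1; split=> //; right].
have [s sst [eos los dich]] := IHj (ltnW ltjT).
have [small|large] := ltnP (8 * #|rows s|) (7 * #|rows top|).
  by exists s => //; split=> //; [lia | left].
have os : 0 < #|outs s| by lia.
have [s1 sst1 [eos1 los1 dich1]] := shrink_step vt eot sst eos os large.
have [small1|large1] := ltnP (8 * #|rows s1|) (7 * #|rows top|).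
  by exists s1 => //; split=> //; [lia | left].
have os1 : 0 < #|outs s1| by lia.
have [s2 sst2 [eos2 los2 dich2]] := shrink_step vt eot sst1 eos1 os1 large1.
exists s2 => //; split=> //; first by lia.
case: dich2 => [|dich2]; [by left | right]; rewrite expnS.
have := subset_leq_card (substate_rows sst); lia.
Qed.

(** Each of [6 * T] stages costs at most [2 * T] ends. With more than [12 * T ^ 2] ends some row
    would survive them all, but the factors [7/8] push the count below one. *)
Lemma card_outs_le s T : valid s -> #|outs s| = #|ins s| -> #|rows s| < 2 ^ T ->
  #|outs s| <= 12 * T ^ 2.
Proof.
move=> vs eos NT; rewrite leqNgt; apply/negP=> many.
suff /(_ (6 * T) (leqnn _)) [s' ss' [_ los decr]] : forall h, h <= 6 * T ->
    exists2 s', substate s' s &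
    [/\ #|outs s'| = #|ins s'|, #|outs s| <= #|outs s'| + h * T.*2 &
        #|rows s'| * 8 ^ h <= 7 ^ h * #|rows s|].
  have rs' : 0 < #|rows s'|.
    apply: leq_trans (subset_leq_card (sub_outs_rows s')); lia.
  have : 7 ^ (6 * T) * 2 ^ T <= 8 ^ (6 * T).
    (* Six stages halve the number of rows, so [6 * T] of them divide it by [2 ^ T]. *)
    have ratio : 7 ^ 6 * 2 <= 8 ^ 6 by rewrite !expnS !expn0; lia.
    rewrite !expnM -expnMn; case: (posnP T) => [->|T0]; first by rewrite !expn0.
    by rewrite leq_exp2r.
  have : 0 < 7 ^ (6 * T) by rewrite expn_gt0.
  move: (7 ^ _) (8 ^ _) decr => a b decr a0 ab; nia.
elim=> [_|h IHh lth].
  exists s; first exact: substate_refl.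
  by rewrite !expn0 addn0 muln1 mul1n.
have [s1 ss1 [eos1 los1 decr1]] := IHh (ltnW lth).
have v1 := valid_substate vs ss1.
have r1 : #|rows s1| <= #|rows s| := subset_leq_card (substate_rows ss1).
have oT : T.*2 <= #|outs s1| by nia.
have pos : 0 < #|rows s1| < 2 ^ T.
  rewrite (leq_ltn_trans r1 NT) andbT.
  by apply: leq_trans (subset_leq_card (sub_outs_rows s1)); nia.
have [s2 ss2 [eos2 los2 decr2]] := shrink_stage v1 eos1 pos oT.
exists s2; first exact: substate_trans ss2 ss1.
split=> //; first by lia.
rewrite !expnS; move: (8 ^ h) (7 ^ h) decr1 => a b decr1; nia.
Qed.

End Switching.

(** * Application to proper edge-colorings of complete graphs *)

Section EdgeColorings.

Variables (V : finType) (K : eqType) (c : {set V} -> K).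
Hypothesis proper_c : proper_edge_coloring (complete_graph V) c.

Lemma proper_inj (x y z : V) :
  x != y -> x != z -> c [set x; y] = c [set x; z] -> y = z.
Proof.
move=> nxy nxz; apply: contra_eq => nyz; apply: (proper_c (v := x)).
- by rewrite inE cards2 nxy.
- by rewrite inE cards2 nxz.
- exact: set21.
- exact: set21.
apply/eqP=> /setP/(_ y); rewrite !inE eqxx orbT (negPf nyz) orbF.
by rewrite eq_sym (negPf nxy).
Qed.

(** One set is chosen for each color; the default is never taken, since [e] passes the test. *)
Definition rep (e : {set V}) : {set V} := odflt e [pick f | c f == c e].

Lemma color_rep e : c (rep e) = c e.
Proof. by rewrite /rep; case: pickP => [f /eqP|]. Qed.

Lemma rep_eq e f : c e = c f -> rep e = rep f.
Proof.
move=> cef; rewrite /rep (eq_pick (_ : _ =1 (fun g => c g == c f))).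
  by case: pickP => // /(_ f); rewrite eqxx.
by move=> g; rewrite cef.
Qed.

(* [rep] makes the colors a finite type, so that sets of colors have sizes. *)
Lemma rainbow_linear_forest T : #|V| < 2 ^ T ->
  exists M : {set V * V}, [/\ linear_forest M,
    {in M &, injective (fun e => c [set e.1; e.2])} &
    #|V| <= #|M| + 12 * T ^ 2].
Proof.
move=> VT; pose col x y := rep [set x; y].
have col_sym x y : col x y = col y x by rewrite /col setUC.
have col_inj x y z : x != y -> x != z -> col x y = col x z -> y = z.
  by move=> nxy nxz /(congr1 c); rewrite !color_rep; apply: proper_inj.
pose good M := `[< linear_forest M /\ rainbow col M >].
have good0 : good set0.
  apply/asboolP; split; last by move=> e; rewrite inE.
  by split=> [x y z|x y z|x y]; rewrite inE.
case: (arg_maxnP (fun M : {set V * V} => #|M|) good0) => M /asboolP[lM rM] maxM.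
exists M; split=> // [e f eM fM /rep_eq|]; first exact: rM.
(* All ends and starts of the largest forest are made available, so [outs s] measures how far [M] is
   from [#|V|] arcs. *)
pose s : state V := (M, [set x | no_out M x], [set y | no_in M y]).
have vs : valid col #|M| s.
  by split=> // x; rewrite inE.
have eos : #|outs s| = #|ins s|.
  by apply: (@addIn #|M|); rewrite card_no_out ?card_no_in.
rewrite -(card_no_out lM) addnC leq_add2l.
apply: (card_outs_le col_sym col_inj _ vs eos).
  by move=> M' lM' rM'; apply: maxM; apply/asboolP.
by apply: leq_ltn_trans VT; apply: max_card.
Qed.

(** The cycle through all arcs of the rainbow forest shows at least as many colors as the forest has
    arcs. *)
Lemma hamiltonian_cycle_colors T : 2 < #|V| < 2 ^ T ->
  exists s : seq V, hamiltonian_cycle (complete_graph V) s /\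
    #|V| <= num_colors c (cycle_edges s) + 12 * T ^ 2.
Proof.
case/andP=> V3 VT; have [M [lM rM leM]] := rainbow_linear_forest VT.
have [s [us ms cs nexts]] := linear_forest_cycle (ltnW V3) lM.
exists s; split.
  split=> //; first by rewrite -(card_uniqP us) (eq_card (B := V)).
  by rewrite /ucycle us andbT; apply: sub_cycle cs => x y nxy; rewrite inE cards2 nxy.
apply: leq_trans leM _; rewrite leq_add2r cardE.
rewrite -(size_map (fun e : V * V => c [set e.1; e.2])).
apply: uniq_leq_size.
  rewrite map_inj_in_uniq ?enum_uniq // => e f; rewrite !mem_enum; exact: rM.
move=> _ /mapP[[x y] + ->]; rewrite mem_enum /= => xy.
rewrite mem_undup map_f // -(nexts _ _ xy); exact: (map_f (fun x => [set x; next s x])).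
Qed.

End EdgeColorings.

(** * The bound in terms of real logarithms *)

Import Order.TTheory GRing.Theory Num.Theory.

Theorem theorem3 (R : realType) :
  exists C : R, forall n : nat, 3 <= n ->
    forall (V : finType) (K : eqType) (c : {set V} -> K),
      #|V| = n ->
      proper_edge_coloring (complete_graph V) c ->
      exists s : seq V,
        hamiltonian_cycle (complete_graph V) s /\
        (n%:R - C * log2 n%:R ^+ 2 <= (num_colors c (cycle_edges s))%:R :> R)%R.
Proof.
(* The bound is applied with [T = t + 1], where [t] is the integer part of the logarithm. As
   [t >= 1], [T <= 2 * t], so [12 * T ^ 2 <= 48 * t ^ 2]. *)
exists 48%:R%R => n n3 V K c Vn proper_c.
pose t := trunc_log 2 n.
have n_lt : n < 2 ^ t.+1 by apply: trunc_log_ltn.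
have le_n : 2 ^ t <= n by apply: trunc_logP => //; apply: ltn_trans n3.
have t0 : 0 < t by rewrite trunc_log_gt0 /= ; lia.
have [|s [hs colors]] := @hamiltonian_cycle_colors V K c proper_c t.+1.
  by rewrite Vn n3.
exists s; split=> //.
have ln2 : (0 < ln 2 :> R)%R by apply: exp.ln_gt0; rewrite ltr1n.
have t_le : (t%:R <= log2 n%:R :> R)%R.
  rewrite /log2 ler_pdivlMr // mulr_natl -lnXn // -natrX.
  by rewrite ler_ln ?ler_nat // posrE ltr0n ?expn_gt0 //; apply: ltn_trans n3.
have {}colors : n <= num_colors c (cycle_edges s) + 48 * t ^ 2.
  rewrite -Vn; apply: leq_trans colors _; rewrite leq_add2l; nia.
rewrite lerBlDr; apply: le_trans (_ : _ <= (_ + 48 * t ^ 2)%:R)%R _.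
  by rewrite ler_nat; exact: colors.
rewrite natrD lerD2l natrM ler_pM2l ?ltr0n // natrX.
by rewrite lerXn2r ?nnegrE // (le_trans _ t_le).
Qed.
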